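(* Let $\mathbb{F}$ be a finite field with $q$ elements, and let $\lambda\in\mathbb{F}\setminus\{0\}$. Let $(D_2,t_{(\lambda,\lambda)})$ be the algebra $D_2=\mathbb{F}\oplus\mathbb{F}$ with the trace $t_{(\lambda,\lambda)}(a,b)=\lambda(a+b)(1,1)$. Then $\mathrm{Id}(D_2,t_{(\lambda,\lambda)})$ follows from (that is, is equal to the T-ideal generated by) the following polynomials: (i) $(\lambda^{-1}t(x))^2-\lambda^{-1}t(x^2)-2(\lambda^{-1}t(x)-x)x$; (ii) $x^q-x$; (iii) all Capelli polynomials of order $3$; (iv) $t(1)-2\lambda$.
   Context: Algebras are associative over $\mathbb{F}$. A trace on an algebra $\mathcal{A}$ is an $\mathbb{F}$-linear map $t:\mathcal{A}\to\mathcal{A}$ such that for all $a,b$: $t(a)\in Z(\mathcal{A})$, $t(ab)=t(ba)$, $t(t(a)b)=t(a)t(b)$. A trace algebra is an algebra with a trace. $\mathbb{F}\langle X,t\rangle$ denotes the free unital associative trace algebra freely generated by an infinite set $X$ of variables, i.e. the free algebra of the variety of unital associative algebras with a linear unary operation $t$ satisfying $t(x)y=yt(x)$, $t(xy)=t(yx)$, $t(t(x)y)=t(x)t(y)$ (here $t(1)$ is not assumed to be a scalar). A scalar in a polynomial stands for that multiple of $1$. For a unital trace algebra $(\mathcal{A},t)$, $\mathrm{Id}(\mathcal{A},t)\subseteq\mathbb{F}\langle X,t\rangle$ is the set of all trace polynomials vanishing under every substitution of the variables by elements of $\mathcal{A}$. A T-ideal is a two-sided ideal of $\mathbb{F}\langle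 X,t\rangle$ closed under $t$ and under all (trace-algebra) endomorphisms of $\mathbb{F}\langle X,t\rangle$; $\langle S\rangle$ is the smallest T-ideal containing $S$. ''$\mathrm{Id}(\mathcal{A},t)$ follows from $S$'' means $\mathrm{Id}(\mathcal{A},t)=\langle S\rangle$. A Capelli polynomial of order $m$ is a multilinear polynomial $f(x_1,\ldots,x_m,y_1,\ldots,y_r)\in\mathbb{F}\langle X,t\rangle$ that is alternating in $\{x_1,\ldots,x_m\}$. In the paper, each Capelli polynomial of order $m$ is a consequence of $[x,y]=xy-yx$ and the single polynomial $\sum_{\sigma\in\mathcal{S}_m}(-1)^\sigma t(y_1x_{\sigma(1)})\cdots t(y_{m-1}x_{\sigma(m-1)})y_mx_{\sigma(m)}$, where $(-1)^\sigma$ is the sign of $\sigma$. *)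

(* Defs.v *)
From HB Require Import structures.
From mathcomp Require Import all_boot all_order all_algebra.
From mathcomp Require Import boolp classical_sets cardinality.

Set Implicit Arguments.
Unset Strict Implicit.
Unset Printing Implicit Defensive.

Import GRing.Theory.

Local Open Scope classical_set_scope.
Local Open Scope ring_scope.
Local Open Scope quotient_scope.

(* Unital (nontrivial) associative algebras with trace over F. *)

HB.mixin Record hasTrace (F : fieldType) A of GRing.Algebra F A := {
  tr : A -> A;
  tr_is_linear : linear tr;
  tr_central : forall a b : A, tr a * b = b * tr a;
  trC : forall a b : A, tr (a * b) = tr (b * a);
  trM : forall a b : A, tr (tr a * b) = tr a * tr b
}.

#[short(type="traceAlgType")]
HB.structure Definition TraceAlgebra (F : fieldType) :=
  {A of GRing.Algebra F A & hasTrace F A}.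

HB.instance Definition _ (F : fieldType) (A : traceAlgType F) :=
  GRing.isLinear.Build F A A *:%R (@tr F A) (@tr_is_linear F A).

Definition trace_morphism (F : fieldType) (A B : traceAlgType F)
  (phi : A -> B) : Prop := {morph phi : a / tr a}.

(* The free trace algebra, as the algebra of terms modulo the congruence       *)
(* generated by the axioms of unital trace algebras. Its universal property is *)
(* given by tevalX, teval_trace and teval_unique below.                        *)

Inductive tterm (F X : Type) : Type :=
| TVar of X
| TZero
| TOne
| TAdd of tterm F X & tterm F X
| TScale of F & tterm F X
| TMul of tterm F X & tterm F X
| TTr of tterm F X.

Arguments TVar {F X}.
Arguments TZero {F X}.
Arguments TOne {F X}.

HB.instance Definition _ (F X : Type) := gen_eqMixin (tterm F X).
HB.instance Definition _ (F X : Type) := gen_choiceMixin (tterm F X).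

Inductive tcong (F : fieldType) (X : Type) : tterm F X -> tterm F X -> Prop :=
| tc_refl p : tcong p p
| tc_sym p q : tcong p q -> tcong q p
| tc_trans p q r : tcong p q -> tcong q r -> tcong p r
| tc_add p p' q q' : tcong p p' -> tcong q q' -> tcong (TAdd p q) (TAdd p' q')
| tc_scale c p p' : tcong p p' -> tcong (TScale c p) (TScale c p')
| tc_mul p p' q q' : tcong p p' -> tcong q q' -> tcong (TMul p q) (TMul p' q')
| tc_tr p p' : tcong p p' -> tcong (TTr p) (TTr p')
| tc_addA p q r : tcong (TAdd p (TAdd q r)) (TAdd (TAdd p q) r)
| tc_addC p q : tcong (TAdd p q) (TAdd q p)
| tc_add0 p : tcong (TAdd TZero p) p
| tc_addN p : tcong (TAdd (TScale (-1) p) p) TZero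
| tc_scaleA c d p : tcong (TScale c (TScale d p)) (TScale (c * d) p)
| tc_scale1 p : tcong (TScale 1 p) p
| tc_scaleDr c p q :
    tcong (TScale c (TAdd p q)) (TAdd (TScale c p) (TScale c q))
| tc_scaleDl c d p :
    tcong (TScale (c + d) p) (TAdd (TScale c p) (TScale d p))
| tc_mulA p q r : tcong (TMul p (TMul q r)) (TMul (TMul p q) r)
| tc_mul1l p : tcong (TMul TOne p) p
| tc_mul1r p : tcong (TMul p TOne) p
| tc_mulDl p q r : tcong (TMul (TAdd p q) r) (TAdd (TMul p r) (TMul q r))
| tc_mulDr p q r : tcong (TMul p (TAdd q r)) (TAdd (TMul p q) (TMul p r))
| tc_scaleAl c p q : tcong (TScale c (TMul p q)) (TMul (TScale c p) q)
| tc_scaleAr c p q : tcong (TScale c (TMul p q)) (TMul p (TScale c q))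
| tc_trD p q : tcong (TTr (TAdd p q)) (TAdd (TTr p) (TTr q))
| tc_trZ c p : tcong (TTr (TScale c p)) (TScale c (TTr p))
| tc_tr_central p q : tcong (TMul (TTr p) q) (TMul q (TTr p))
| tc_trC p q : tcong (TTr (TMul p q)) (TTr (TMul q p))
| tc_trM p q : tcong (TTr (TMul (TTr p) q)) (TMul (TTr p) (TTr q)).

Fixpoint term_eval (F : fieldType) (X : Type) (A : traceAlgType F) (v : X -> A)
    (p : tterm F X) : A :=
  match p with
  | TVar x => v x
  | TZero => 0
  | TOne => 1
  | TAdd p q => term_eval v p + term_eval v q
  | TScale c p => c *: term_eval v p
  | TMul p q => term_eval v p * term_eval v q
  | TTr p => tr (term_eval v p)
  end.

Lemma term_eval_cong (F : fieldType) (X : Type) (A : traceAlgType F)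
    (v : X -> A) (p q : tterm F X) :
  tcong p q -> term_eval v p = term_eval v q.
Proof.
elim=> //=; try by move=> *; congruence.
- by move=> *; rewrite addrA.
- by move=> *; rewrite addrC.
- by move=> *; rewrite add0r.
- by move=> *; rewrite scaleN1r addNr.
- by move=> *; rewrite scalerA.
- by move=> *; rewrite scale1r.
- by move=> *; rewrite scalerDr.
- by move=> *; rewrite scalerDl.
- by move=> *; rewrite mulrA.
- by move=> *; rewrite mul1r.
- by move=> *; rewrite mulr1.
- by move=> *; rewrite mulrDl.
- by move=> *; rewrite mulrDr.
- by move=> *; rewrite scalerAl.
- by move=> *; rewrite scalerAr.
- by move=> *; rewrite linearD.
- by move=> *; rewrite linearZ.
- by move=> *; rewrite tr_central.
- by move=> *; rewrite trC.
- by move=> *; rewrite trM.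
Qed.

Section FreeTraceAlgebra.

Variables (F : fieldType) (X : Type).

Definition tcongb (p q : tterm F X) : bool := `[< tcong p q >].

Lemma tcongb_equiv : equiv_class_of tcongb.
Proof.
split.
- by move=> p; apply/asboolP; exact: tc_refl.
- by move=> p q; apply/asboolP/asboolP; exact: tc_sym.
- by move=> q p r /asboolP pq /asboolP qr; apply/asboolP; exact: tc_trans qr.
Qed.

Canonical tcong_equiv := EquivRelPack tcongb_equiv.

Definition tfree := {eq_quot tcong_equiv}.

HB.instance Definition _ := Choice.on tfree.
HB.instance Definition _ := EqQuotient.on tfree.

Lemma tfreeP (p q : tterm F X) : \pi_tfree p = \pi_tfree q <-> tcong p q.
Proof. by split=> [/eqmodP/asboolP|pq]; last apply/eqmodP/asboolP. Qed.

Lemma tfree_repr (p : tterm F X) : tcong (repr (\pi_tfree p)) p.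
Proof. by apply/tfreeP; rewrite reprK. Qed.

Definition tvar (x : X) : tfree := \pi_tfree (TVar x).

Definition tzero : tfree := \pi_tfree TZero.
Definition tone : tfree := \pi_tfree TOne.
Definition tadd := lift_op2 tfree (@TAdd F X).
Definition tscale c := lift_op1 tfree (@TScale F X c).
Definition tmul := lift_op2 tfree (@TMul F X).
Definition ttr := lift_op1 tfree (@TTr F X).

Lemma taddE p q : tadd (\pi_tfree p) (\pi_tfree q) = \pi_tfree (TAdd p q).
Proof. by unlock tadd; apply/tfreeP; apply: tc_add; exact: tfree_repr. Qed.
Lemma tscaleE c p : tscale c (\pi_tfree p) = \pi_tfree (TScale c p).
Proof. by unlock tscale; apply/tfreeP; apply: tc_scale; exact: tfree_repr. Qed.
Lemma tmulE p q : tmul (\pi_tfree p) (\pi_tfree q) = \pi_tfree (TMul p q).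
Proof. by unlock tmul; apply/tfreeP; apply: tc_mul; exact: tfree_repr. Qed.
Lemma ttrE p : ttr (\pi_tfree p) = \pi_tfree (TTr p).
Proof. by unlock ttr; apply/tfreeP; apply: tc_tr; exact: tfree_repr. Qed.

Let tE := (taddE, tscaleE, tmulE, ttrE).

Lemma tfree_ind (P : tfree -> Prop) :
  (forall p, P (\pi_tfree p)) -> forall f, P f.
Proof. by move=> H f; rewrite -[f]reprK. Qed.

Lemma taddA : associative tadd.
Proof.
do 3![elim/tfree_ind=> ?]; rewrite !tE; apply/tfreeP; exact: tc_addA.
Qed.
Lemma taddC : commutative tadd.
Proof. do 2![elim/tfree_ind=> ?]; rewrite !tE; apply/tfreeP; exact: tc_addC. Qed.
Lemma tadd0 : left_id tzero tadd.
Proof. elim/tfree_ind=> ?; rewrite !tE; apply/tfreeP; exact: tc_add0. Qed.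
Lemma taddN : left_inverse tzero (tscale (-1)) tadd.
Proof. elim/tfree_ind=> ?; rewrite !tE; apply/tfreeP; exact: tc_addN. Qed.

HB.instance Definition _ :=
  GRing.isZmodule.Build tfree taddA taddC tadd0 taddN.

Lemma tmulA : associative tmul.
Proof.
do 3![elim/tfree_ind=> ?]; rewrite !tE; apply/tfreeP; exact: tc_mulA.
Qed.
Lemma tmul1l : left_id tone tmul.
Proof. elim/tfree_ind=> ?; rewrite !tE; apply/tfreeP; exact: tc_mul1l. Qed.
Lemma tmul1r : right_id tone tmul.
Proof. elim/tfree_ind=> ?; rewrite !tE; apply/tfreeP; exact: tc_mul1r. Qed.
Lemma tmulDl : left_distributive tmul tadd.
Proof.
do 3![elim/tfree_ind=> ?]; rewrite !tE; apply/tfreeP; exact: tc_mulDl.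
Qed.
Lemma tmulDr : right_distributive tmul tadd.
Proof.
do 3![elim/tfree_ind=> ?]; rewrite !tE; apply/tfreeP; exact: tc_mulDr.
Qed.

(* Evaluation in the algebra F with the zero trace separates 1 from 0. *)
Fixpoint term_aug (p : tterm F X) : F :=
  match p with
  | TVar _ => 0
  | TZero => 0
  | TOne => 1
  | TAdd p q => term_aug p + term_aug q
  | TScale c p => c * term_aug p
  | TMul p q => term_aug p * term_aug q
  | TTr p => 0
  end.

Lemma term_aug_cong p q : tcong p q -> term_aug p = term_aug q.
Proof.
elim=> //=; try (by move=> *; congruence); move=> *;
  rewrite ?mulN1r ?addNr ?add0r ?addr0 ?mul0r ?mulr0 ?mul1r ?mulr1 //.
- exact: addrA.
- exact: addrC.
- exact: mulrA.
- exact: mulrDr.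
- exact: mulrDl.
- exact: mulrA.
- exact: mulrDl.
- exact: mulrDr.
- exact: mulrA.
- exact: mulrCA.
Qed.

Lemma tone_neq0 : tone != 0.
Proof.
by apply/eqP => /tfreeP/term_aug_cong/= /eqP; rewrite oner_eq0.
Qed.

HB.instance Definition _ := GRing.Zmodule_isNzRing.Build tfree
  tmulA tmul1l tmul1r tmulDl tmulDr tone_neq0.

Lemma tscaleA a b (f : tfree) : tscale a (tscale b f) = tscale (a * b) f.
Proof. elim/tfree_ind: f=> ?; rewrite !tE; apply/tfreeP; exact: tc_scaleA. Qed.
Lemma tscale1 : left_id 1 tscale.
Proof. elim/tfree_ind=> ?; rewrite !tE; apply/tfreeP; exact: tc_scale1. Qed.
Lemma tscaleDr : right_distributive tscale +%R.
Proof.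
move=> c; do 2![elim/tfree_ind=> ?].
rewrite /GRing.add /= !tE; apply/tfreeP; exact: tc_scaleDr.
Qed.
Lemma tscaleDl (f : tfree) : {morph tscale^~ f : a b / a + b}.
Proof.
elim/tfree_ind: f => ? a b.
rewrite [in RHS]/GRing.add /= !tE; apply/tfreeP; exact: tc_scaleDl.
Qed.

HB.instance Definition _ := GRing.Zmodule_isLmodule.Build F tfree
  tscaleA tscale1 tscaleDr tscaleDl.

Lemma tscaleAl (c : F) (f g : tfree) : c *: (f * g) = (c *: f) * g.
Proof.
elim/tfree_ind: f => ?; elim/tfree_ind: g => ?.
rewrite /GRing.scale /GRing.mul /= !tE; apply/tfreeP; exact: tc_scaleAl.
Qed.

HB.instance Definition _ := GRing.Lmodule_isLalgebra.Build F tfree tscaleAl.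

Lemma tscaleAr (c : F) (f g : tfree) : c *: (f * g) = f * (c *: g).
Proof.
elim/tfree_ind: f => ?; elim/tfree_ind: g => ?.
rewrite /GRing.scale /GRing.mul /= !tE; apply/tfreeP; exact: tc_scaleAr.
Qed.

HB.instance Definition _ := GRing.Lalgebra_isAlgebra.Build F tfree tscaleAr.

Lemma ttr_linear : linear ttr.
Proof.
move=> c; do 2![elim/tfree_ind=> ?].
rewrite /GRing.add /GRing.scale /= !tE; apply/tfreeP.
apply: (tc_trans (tc_trD _ _)); apply: tc_add; [exact: tc_trZ | exact: tc_refl].
Qed.
Lemma ttr_central (f g : tfree) : ttr f * g = g * ttr f.
Proof.
elim/tfree_ind: f => ?; elim/tfree_ind: g => ?.
rewrite /GRing.mul /= !tE; apply/tfreeP; exact: tc_tr_central.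
Qed.
Lemma ttrC (f g : tfree) : ttr (f * g) = ttr (g * f).
Proof.
elim/tfree_ind: f => ?; elim/tfree_ind: g => ?.
rewrite /GRing.mul /= !tE; apply/tfreeP; exact: tc_trC.
Qed.
Lemma ttrM (f g : tfree) : ttr (ttr f * g) = ttr f * ttr g.
Proof.
elim/tfree_ind: f => ?; elim/tfree_ind: g => ?.
rewrite /GRing.mul /= !tE; apply/tfreeP; exact: tc_trM.
Qed.

HB.instance Definition _ :=
  hasTrace.Build F tfree ttr_linear ttr_central ttrC ttrM.

Section Evaluation.

Variables (A : traceAlgType F) (v : X -> A).

Definition teval (f : tfree) : A := term_eval v (repr f).

Lemma tevalE p : teval (\pi_tfree p) = term_eval v p.
Proof. exact/term_eval_cong/tfree_repr. Qed.

Lemma teval_linear : linear teval.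
Proof.
move=> c; do 2![elim/tfree_ind=> ?].
by rewrite {1}/GRing.add {1}/GRing.scale /= !tE !tevalE.
Qed.

Lemma teval_monoid_morphism : monoid_morphism teval.
Proof.
split=> [|]; first exact: tevalE.
by do 2![elim/tfree_ind=> ?]; rewrite {1}/GRing.mul /= !tE !tevalE.
Qed.

HB.instance Definition _ :=
  GRing.isLinear.Build F tfree A *:%R teval teval_linear.
HB.instance Definition _ :=
  GRing.isMonoidMorphism.Build tfree A teval teval_monoid_morphism.

Lemma tevalX x : teval (tvar x) = v x.
Proof. exact: tevalE. Qed.

Lemma teval_trace : trace_morphism teval.
Proof. by elim/tfree_ind=> ?; rewrite {1}/tr /= !tE !tevalE. Qed.

Lemma teval_unique (phi : {lrmorphism tfree -> A}) :
  trace_morphism phi -> (forall x, phi (tvar x) = v x) -> phi =1 teval.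
Proof.
move=> phit phiX; elim/tfree_ind=> p; rewrite tevalE.
elim: p => /= [x|||p IHp q IHq|c p IHp|p IHp q IHq|p IHp].
- exact: phiX.
- exact: (rmorph0 phi).
- exact: (rmorph1 phi).
- by rewrite -IHp -IHq -rmorphD /= [in RHS]/GRing.add /= !tE.
- by rewrite -IHp -linearZ /= [in RHS]/GRing.scale /= !tE.
- by rewrite -IHp -IHq -rmorphM /= [in RHS]/GRing.mul /= !tE.
- by rewrite -IHp -phit [in RHS]/tr /= !tE.
Qed.

End Evaluation.

End FreeTraceAlgebra.

Arguments tvar {F X}.

Section TIdeals.

Variables (F : fieldType) (X : Type).

Definition trace_identities (A : traceAlgType F) : set (tfree F X) :=
  [set f | forall v : X -> A, teval v f = 0].

Record is_Tideal (I : set (tfree F X)) : Prop := {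
  Tideal0 : I 0;
  TidealD : forall f g, I f -> I g -> I (f + g);
  TidealMl : forall g f, I f -> I (g * f);
  TidealMr : forall f g, I f -> I (f * g);
  Tideal_tr : forall f, I f -> I (tr f);
  Tideal_endo : forall phi : {lrmorphism tfree F X -> tfree F X},
    trace_morphism phi -> forall f, I f -> I (phi f)
}.

Definition Tideal_gen (S : set (tfree F X)) : set (tfree F X) :=
  smallest is_Tideal S.

End TIdeals.

Arguments trace_identities {F} X A.

Section Capelli.

Variables (F : fieldType) (X : choiceType).

Inductive tmonomial : Type :=
| MVar of X
| MOne
| MMul of tmonomial & tmonomial
| MTr of tmonomial.

Fixpoint mono (m : tmonomial) : tfree F X :=
  match m with
  | MVar x => tvar x
  | MOne => 1
  | MMul m n => mono m * mono n
  | MTr m => tr (mono m)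
  end.

(* The occurrences of variables, with multiplicity. *)
Fixpoint mono_vars (m : tmonomial) : seq X :=
  match m with
  | MVar x => [:: x]
  | MOne => [::]
  | MMul m n => mono_vars m ++ mono_vars n
  | MTr m => mono_vars m
  end.

(* Multilinearity over a finite field is a condition on the monomials: the     *)
(* polynomial function x |-> tr x ^+ #|F| is additive and homogeneous of       *)
(* degree one.                                                                 *)
Definition multilinear (vs : seq X) : set (tfree F X) :=
  [set f | uniq vs /\ exists2 s : seq (F * tmonomial),
     all (fun cm => perm_eq (mono_vars cm.2) vs) s &
     f = \sum_(cm <- s) cm.1 *: mono cm.2].

(* f vanishes when a variable of xs is replaced by another one; for            *)
(* multilinear f in characteristic not 2 this is the same as changing sign     *)
(* under transpositions, in characteristic 2 it is stronger.                   *)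
Definition alternating (xs : seq X) (f : tfree F X) : Prop :=
  forall x y, x \in xs -> y \in xs -> x != y ->
    teval (fun z => if z == y then tvar x else tvar z) f = 0.

Definition Capelli (m : nat) : set (tfree F X) :=
  [set f | exists xs ys : seq X,
     [/\ size xs = m, multilinear (xs ++ ys) f & alternating xs f]].

End Capelli.

Arguments Capelli F X m : clear implicits.

Section D2.

Variables (F : fieldType) (lambda : F).

(* The parameter is only there to let the type determine the trace. *)
Definition D2 of F : Type := (F^o * F^o)%type.
Local Notation D := (D2 lambda).

HB.instance Definition _ := GRing.Algebra.on D.

Definition D2_tr (a : D) : D := (lambda * (a.1 + a.2)) *: (1, 1).

Lemma D2_tr_linear : linear D2_tr.
Proof.
move=> c [a1 a2] [b1 b2]; rewrite /D2_tr scalerA -scalerDl /=.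
congr (_ *: _); rewrite mulrCA -mulrDr; congr (_ * _).
by rewrite mulrDr addrACA.
Qed.

Lemma D2_mulC (a b : D) : a * b = b * a.
Proof. by case: a b => [a1 a2] [b1 b2]; congr pair; exact: mulrC. Qed.

Lemma D2_tr_central (a b : D) : D2_tr a * b = b * D2_tr a.
Proof. exact: D2_mulC. Qed.

Lemma D2_trC (a b : D) : D2_tr (a * b) = D2_tr (b * a).
Proof. by rewrite D2_mulC. Qed.

Lemma D2_trM (a b : D) : D2_tr (D2_tr a * b) = D2_tr a * D2_tr b.
Proof.
have scaleE (c : F) (d : D) : (c *: (1, 1) : D) * d = c *: d.
  by rewrite -scalerAl mul1r.
rewrite [D2_tr a]/D2_tr !scaleE /D2_tr scalerA; congr (_ *: _) => /=.
by rewrite -mulrDr mulrCA.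
Qed.

HB.instance Definition _ := hasTrace.Build F D
  D2_tr_linear D2_tr_central D2_trC D2_trM.

End D2.

(* Main.v *)
Require Import Defs.
From HB Require Import structures.
From mathcomp Require Import all_boot all_order all_algebra.
From mathcomp Require Import finfield.
From mathcomp Require Import boolp classical_sets cardinality.
From mathcomp Require Import ring zify.

(** Every generator holds in [D2 lambda]: the first one reads
    [(a + b) ^ 2 - (a ^ 2 + b ^ 2) - 2 b a = 0] in the coordinate [a] of [(a, b)],
    and a Capelli polynomial of
    order 3 vanishes because the algebra has dimension 2 ([Capelli_vanish]). The
    identities of an algebra form a T-ideal, which gives one inclusion.

    For the other one, let [A] be the quotient of the free trace algebra by the
    T-ideal generated. An element belongs to that T-ideal if and only if it is an
    identity of [A] ([tquot_identities]), so it suffices that [A] satisfies all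
    identities of [D2 lambda] ([D2_identities_hold]). Write [q] for the number of
    elements of [F].

    Since [x ^ q = x] in [A], the algebra is reduced and each [x] is a combination
    of the idempotents [1 - (x - c) ^ (q - 1)], where [c] runs over [F]. Idempotents
    of a reduced algebra are central, so [A] is commutative ([frob_comm]).

    Put [u = lambda^-1 t] and [s a = u a - a]. In [D2 lambda] the map [s] exchanges
    the two coordinates. The crux is that [s] is multiplicative on [A]
    ([swap_mul]). It need only be checked on idempotents, and then on orthogonal
    ones [g] and [h]; with [k = 1 - g - h], the Capelli polynomial gives
    [u g * u h * k = 0] and its permutations, and the first generator, which on an
    idempotent [e] reads [(u e - 1) (u e - 2 e) = 0], does the rest.

    Now a ring homomorphism [f] from [A] to [F] yields the homomorphism of trace
    algebras [a |-> (f a, f (s a))] to [D2 lambda], because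
    [t a = lambda (a + s a)] and [s (t a) = t a]. There are enough of these to
    separate the points of [A]. As an identity involves finitely many variables,
    an explicit joint eigenvector of these variables and of their images by [s]
    can play the part of [f] ([joint_eigenvector], [eigen_term_eval]). *)

Set Implicit Arguments.
Unset Strict Implicit.
Unset Printing Implicit Defensive.

Import GRing.Theory.

Local Open Scope classical_set_scope.
Local Open Scope ring_scope.

(** * Algebras in which every element satisfies the equation of the finite field *)

(** As a function on [F] this is the indicator of [c]: a nonzero element of [F]
    has [#|F|.-1]-th power 1. *)
Definition chi_poly (F : finFieldType) (c : F) : {poly F} :=
  1 - ('X - c%:P) ^+ #|F|.-1.

(** Both sides agree at every point of [F], and their difference has degree less
    than [#|F|], so it cannot have [#|F|] roots unless it is 0. *)
Lemma sum_chi_poly (F : finFieldType) : \sum_c chi_poly c = 1 :> {poly F}.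
Proof.
have q_gt1 := finNzRing_gt1 F.
have size_chi (c : F) : (size (chi_poly c) <= #|F|)%N.
  rewrite (leq_trans (size_polyD _ _)) // size_polyN geq_max size_poly1 ltnW //=.
  by rewrite (leq_trans (size_poly_exp_leq _ _)) // size_XsubC mul1n prednK // ltnW.
apply/eqP; rewrite -subr_eq0; apply: contraT => nz.
have roots : all (root (\sum_c chi_poly c - 1)) (enum F).
  apply/allP => a _; rewrite rootE !hornerE horner_sum (bigD1 a) //= big1.
    rewrite /chi_poly !hornerE subrr expr0n.
    by rewrite -subn1 subn_eq0 leqNgt q_gt1 /= subr0 subrr.
  move=> c /negPf ca; rewrite /chi_poly !hornerE.
  have ac : a - c != 0 by rewrite subr_eq0 eq_sym ca.
  apply/eqP; rewrite subr_eq0 eq_sym; apply/eqP/(mulfI ac).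
  by rewrite -exprS prednK ?expf_card ?mulr1 // ltnW.
have := max_poly_roots nz roots (enum_uniq F).
rewrite -cardE ltnNge => /negP[].
rewrite (leq_trans (size_polyD _ _)) // size_polyN geq_max size_poly1 (ltnW q_gt1) andbT.
by rewrite (leq_trans (size_sum _ _ _)) //; apply/bigmax_leqP.
Qed.

Section Frobenius.

Variables (F : finFieldType) (A : algType F).
Hypothesis frobA : forall a : A, a ^+ #|F| = a.

Definition chi (c : F) (a : A) : A := 1 - (a - c%:A) ^+ #|F|.-1.

Lemma sum_chi (a : A) : \sum_c chi c a = 1.
Proof.
have := congr1 (horner_alg a) (sum_chi_poly F).
rewrite rmorph1 rmorph_sum => <-; apply: eq_bigr => c _.
by rewrite /chi_poly rmorphB rmorph1 rmorphXn rmorphB /= horner_algX horner_algC.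
Qed.

(** The element [b = a - c%:A] satisfies [b ^+ #|F| = b], so it kills
    [1 - b ^+ #|F|.-1]. *)
Lemma chi_eigen (c : F) (a : A) : a * chi c a = c *: chi c a.
Proof.
apply/eqP; rewrite -subr_eq0 -[c *: _]mul1r -scalerAr scalerAl -mulrBl.
by rewrite mulrBr mulr1 -exprS prednK ?(ltnW (finNzRing_gt1 F)) // frobA subrr.
Qed.

Lemma chi_idem (c : F) (a : A) : chi c a * chi c a = chi c a.
Proof.
have chi0 : (a - c%:A) * chi c a = 0.
  by rewrite mulrBl chi_eigen -scalerAl mul1r subrr.
rewrite {1}/chi mulrBl mul1r.
case: #|F| (finNzRing_gt1 F) => [|[|n]] //= _.
by rewrite exprSr -mulrA chi0 mulr0 subr0.
Qed.

Lemma chi_decomp (a : A) : a = \sum_c c *: chi c a.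
Proof.
rewrite -[LHS]mulr1 -(sum_chi a) mulr_sumr.
by apply: eq_bigr => c _; exact: chi_eigen.
Qed.

Lemma frob_reduced (a : A) : a * a = 0 -> a = 0.
Proof.
move=> aa; rewrite -[a]frobA.
by case: #|F| (finNzRing_gt1 F) => [|[|n]] //= _; rewrite !exprS mulrA aa mul0r.
Qed.

(** The Peirce components [e a (1 - e)] and [(1 - e) a e] have square zero, so
    they vanish in a reduced algebra. *)
Lemma idem_central (e a : A) : e * e = e -> e * a = a * e.
Proof.
move=> ee; have fe : (1 - e) * e = 0 by rewrite mulrBl mul1r ee subrr.
have ef : e * (1 - e) = 0 by rewrite mulrBr mulr1 ee subrr.
have l0 : e * a * (1 - e) = 0.
  by apply: frob_reduced; rewrite -!mulrA (mulrA (1 - e)) fe mul0r !mulr0.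
have r0 : (1 - e) * a * e = 0.
  by apply: frob_reduced; rewrite -!mulrA (mulrA e) ef mul0r !mulr0.
move: l0 r0; rewrite mulrBr mulr1 mulrBl mul1r mulrBl.
by move=> /subr0_eq l /subr0_eq r; rewrite l r.
Qed.

(** Every element is a combination of idempotents, which are central. *)
Lemma frob_comm (a b : A) : a * b = b * a.
Proof.
rewrite [a]chi_decomp mulr_suml mulr_sumr; apply: eq_bigr => c _.
by rewrite -scalerAl -scalerAr (idem_central _ (chi_idem c a)).
Qed.

End Frobenius.

(** * Multiplicativity of the conjugation attached to the trace *)

(** In [F * F] with [u (a, b) = (a + b, a + b)], the map [a |-> u a - a]
    exchanges the two coordinates, hence is multiplicative. Here this is derived
    from the axioms on [u]. Polarising [uCH] only gives twice the claim, which
    says nothing in characteristic 2; there [uCap], a trace of the fact that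
    three orthogonal idempotents do not fit in dimension 2, is essential. *)
Section SwapMultiplicative.

Variables (F : finFieldType) (R : comAlgType F) (u : {linear R -> R}).
Hypothesis frobR : forall a : R, a ^+ #|F| = a.
Hypothesis u1 : u 1 = 2%:R.
Hypothesis uCH : forall a, u a ^+ 2 - u (a ^+ 2) - 2%:R * (u a - a) * a = 0.
Hypothesis uCap : forall g h k : R,
  g * g = g -> h * h = h -> g * h = 0 -> g * k = 0 -> h * k = 0 ->
  u g * u h * k = 0.

Let B (x y : R) : R := u (x * y) - x * y - (u x - x) * (u y - y).

Let B_C x y : B x y = B y x.
Proof. by rewrite /B (mulrC x) [X in _ - X]mulrC. Qed.

Let B_D x x' y : B (x + x') y = B x y + B x' y.
Proof. by rewrite /B mulrDl !linearD /=; ring. Qed.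

Let B_Z c x y : B (c *: x) y = c *: B x y.
Proof.
by rewrite /B -scalerAl !linearZ /= -!scalerDr -scalerAl -scalerBr.
Qed.

Let B_sum (x : F -> R) y : B (\sum_c x c) y = \sum_c B (x c) y.
Proof.
apply: (big_morph (B^~ y) (fun a b => B_D a b y)).
by have := B_Z 0 0 y; rewrite !scale0r.
Qed.

Let B_diag g : B g g = 0.
Proof. by rewrite -[RHS]oppr0 -[in RHS](uCH g) /B !expr2; ring. Qed.

(** It is enough to multiply by each of [g], [h] and the remaining idempotent
    [k = 1 - g - h]. The component along [k] is an instance of [uCap]. Along [g],
    the instance [u h * u k * g = 0] of [uCap], in which [u k = 2 - u g - u h],
    combines with [(u h ^+ 2 - u h) * g = 0], which is [uCH] for [h]; the
    component along [h] is symmetric. *)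
Let B_orth g h : g * g = g -> h * h = h -> g * h = 0 -> B g h = 0.
Proof.
move=> gg hh gh; pose k := 1 - g - h; pose a := u g; pose b := u h.
have hg : h * g = 0 by rewrite mulrC.
have gk : g * k = 0 by rewrite /k !mulrBr mulr1 gg gh subrr subr0.
have hk : h * k = 0 by rewrite /k !mulrBr mulr1 hh hg subr0 subrr.
have kk : k * k = k by rewrite {1}/k !mulrBl mul1r gk hk !subr0.
have uk : u k = 2%:R - a - b by rewrite /k !linearB /= u1.
have abk : a * b * k = 0 by exact: uCap.
have ach : a * (2%:R - a - b) * h = 0.
  by rewrite -uk; apply: uCap; rewrite // mulrC.
have bcg : b * (2%:R - a - b) * g = 0.
  by rewrite -uk; apply: uCap; rewrite // mulrC.
have CH z y : z * z = z -> z * y = 0 -> (u z ^+ 2 - u z) * y = 0.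
  move=> zz zy; have := congr1 ( *%R^~ y) (uCH z).
  rewrite (expr2 z) zz mul0r => <-.
  rewrite -[LHS]subr0 -(mulr0 (2%:R * (u z - z))) -zy; ring.
have CHh := CH h g hh hg; have CHg := CH g h gg gh.
have -> : B g h = a * h + b * g - a * b.
  by rewrite /B gh raddf0 -/a -/b sub0r; rewrite -[RHS]subr0 -[in RHS]gh; ring.
suff: (a * h + b * g - a * b) * (g + h + k) = 0.
  by have -> : g + h + k = 1 by [rewrite /k; ring]; rewrite mulr1.
have -> : (a * h + b * g - a * b) * (g + h + k) =
    (a + b) * (g * h) + a * (h * h) + b * (g * g) + a * (h * k) + b * (g * k)
    - a * b * g - a * b * h - a * b * k by ring.
rewrite gh gg hh gk hk abk.
have -> : (a + b) * 0 + a * h + b * g + a * 0 + b * 0 - a * b * g - a * b * h - 0 =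
   (a * (2%:R - a - b) * h + (a ^+ 2 - a) * h)
   + (b * (2%:R - a - b) * g + (b ^+ 2 - b) * g) by ring.
by rewrite ach bcg CHh CHg !addr0.
Qed.

(** The defect [B] is bilinear and every element is a combination of idempotents,
    so only [B e f] for idempotents matters; cutting [e] and [f] along their
    product leaves the diagonal term [B (e * f) (e * f)] and values of [B] on
    orthogonal idempotents. *)
Lemma swap_mul (x y : R) : u (x * y) - x * y = (u x - x) * (u y - y).
Proof.
apply/eqP; rewrite -subr_eq0 -/(B x y); apply/eqP.
have B_idem e f : e * e = e -> f * f = f -> B e f = 0.
  move=> ee ff.
  have idC (g : R) : g * g = g -> (1 - g) * (1 - g) = 1 - g.
    by move=> gg; rewrite mulrBr mulr1 mulrBl mul1r gg subrr subr0.
  have idM (g h : R) : g * g = g -> h * h = h -> g * h * (g * h) = g * h.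
    by move=> gg hh; rewrite mulrACA gg hh.
  have fC : (1 - f) * f = 0 by rewrite mulrBl mul1r ff subrr.
  have eC : e * (1 - e) = 0 by rewrite mulrBr mulr1 ee subrr.
  have Be : B e f = B (e * f) f + B (e * (1 - f)) f.
    by rewrite -[RHS]B_D; congr (B _ _); ring.
  have Bf : B (e * f) f = B (e * f) (e * f) + B (e * f) ((1 - e) * f).
    by rewrite (B_C _ f) (B_C _ ((1 - e) * f)) -[RHS]B_D; congr (B _ _); ring.
  rewrite Be Bf B_diag add0r (@B_orth (e * f)) ?(@B_orth (e * (1 - f))) ?addr0 //.
  - by apply: idM => //; exact: idC.
  - by rewrite -mulrA fC mulr0.
  - exact: idM.
  - by apply: idM => //; exact: idC.
  - by rewrite mulrACA eC mul0r.
rewrite (chi_decomp frobR x) B_sum big1 // => c _.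
rewrite B_Z B_C (chi_decomp frobR y) B_sum big1 ?scaler0 // => d _.
by rewrite B_Z B_idem ?scaler0 //; apply: chi_idem.
Qed.

End SwapMultiplicative.

(** * Algebras satisfying the generators satisfy all identities of the target *)

Fixpoint term_vars (F X : Type) (p : tterm F X) : seq X :=
  match p with
  | TVar x => [:: x]
  | TZero | TOne => [::]
  | TAdd p q | TMul p q => term_vars p ++ term_vars q
  | TScale _ p | TTr p => term_vars p
  end.

(** A nonzero multiple of [w] on which each of finitely many elements acts as a
    scalar: since the [chi c z] sum to 1, one of them does not kill [w], and they
    can be applied for one [z] after the other. This stands in for a homomorphism
    to [F] that does not kill [w]. *)
Lemma joint_eigenvector (F : finFieldType) (A : algType F) (zs : seq A) (w : A) :
  (forall a : A, a ^+ #|F| = a) -> w != 0 ->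
  exists2 a, w * a != 0 &
    forall z, z \in zs -> exists c : F, z * (w * a) = c *: (w * a).
Proof.
move=> frobA; have mulA := frob_comm frobA.
elim: zs w => [|z zs IH] w w0; first by exists 1; rewrite ?mulr1.
have [c wc] : exists c, w * chi c z != 0.
  apply/existsP; apply: contraNT w0; rewrite negb_exists => /forallP wz.
  rewrite -[w]mulr1 -(sum_chi z) mulr_sumr big1 // => c _.
  by apply/eqP; have := wz c; rewrite negbK.
have [a wa eig] := IH _ wc; exists (chi c z * a); rewrite ?mulrA // => y.
rewrite inE => /predU1P[->|]; last exact: eig.
exists c; rewrite (mulA w) -(mulrA (chi c z)) mulrA chi_eigen //.
by rewrite -scalerAl.
Qed.

Section Completeness.

Variables (F : finFieldType) (lambda : F) (A : traceAlgType F).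
Hypothesis lambda_neq0 : lambda != 0.
Hypothesis frobA : forall a : A, a ^+ #|F| = a.
Hypothesis tr1 : tr (1 : A) = (2%:R * lambda)%:A.
Hypothesis trCH : forall a : A,
  (lambda^-1 *: tr a) ^+ 2 - lambda^-1 *: tr (a ^+ 2)
    - 2%:R * (lambda^-1 *: tr a - a) * a = 0.
Hypothesis trCap : forall g h k : A,
  g * g = g -> h * h = h -> g * h = 0 -> g * k = 0 -> h * k = 0 ->
  tr g * tr h * k = 0.

Let utr (a : A) : A := lambda^-1 *: tr a.

Let utr_linear : linear utr.
Proof. by move=> c a b; rewrite /utr linearP scalerDr !scalerA mulrC. Qed.

HB.instance Definition _ := GRing.isLinear.Build F A A *:%R utr utr_linear.

(** What exchanging the coordinates becomes in an abstract algebra. *)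
Definition swap (a : A) : A := utr a - a.

Lemma utr1 : utr 1 = 2%:R.
Proof. by rewrite /utr tr1 scalerA mulrCA mulVf // mulr1 scaler_nat. Qed.

Lemma swap1 : swap 1 = 1.
Proof. by rewrite /swap utr1 -[2%:R]/(1 + 1) addrK. Qed.

Lemma swapM (a b : A) : swap (a * b) = swap a * swap b.
Proof.
pose R : comAlgType F := HB.pack (A : algType F)
  (GRing.PzRing_hasCommutativeMul.Build A (frob_comm frobA)).
apply: (@swap_mul F R (utr : {linear A -> A})) => //.
- exact: utr1.
- move=> g h k gg hh gh gk hk.
  change (utr g * utr h * k = 0).
  by rewrite /utr -!scalerAl -scalerAr -scalerAl trCap // !scaler0.
Qed.

Lemma swapD (a b : A) : swap (a + b) = swap a + swap b.
Proof. by rewrite /swap linearD /= opprD addrACA. Qed.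

Lemma swapZ c (a : A) : swap (c *: a) = c *: swap a.
Proof. by rewrite /swap linearZ /= -scalerBr. Qed.

Lemma swap0 : swap 0 = 0.
Proof. by rewrite /swap linear0 subrr. Qed.

Lemma tr_swap (a : A) : tr a = lambda *: (a + swap a).
Proof. by rewrite /swap addrC subrK scalerA divff // scale1r. Qed.

Lemma swap_tr (a : A) : swap (tr a) = tr a.
Proof.
rewrite /swap /utr -[X in tr X]mulr1 trM tr1 -scalerAr mulr1 scalerA.
by rewrite mulrCA mulVf // mulr1 scaler_nat mulr2n addrK.
Qed.

(** The pair of maps [a |-> a], [a |-> swap a], read off on the joint eigenvector
    [w], behaves as a homomorphism of trace algebras to [D2 lambda]. The trace is
    respected because [tr a = lambda *: (a + swap a)] is fixed by [swap]. *)
Lemma eigen_term_eval (X : eqType) (v : X -> A) (d : X -> D2 lambda) (w : A)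
    (p : tterm F X) :
  (forall x, x \in term_vars p ->
     v x * w = (d x).1 *: w /\ swap (v x) * w = (d x).2 *: w) ->
  term_eval v p * w = (term_eval d p).1 *: w /\
  swap (term_eval v p) * w = (term_eval d p).2 *: w.
Proof.
elim: p => /= [x|||p IHp q IHq|c p IHp|p IHp q IHq|p IHp] H.
- by apply: H; rewrite inE.
- by rewrite swap0 mul0r scale0r.
- by rewrite swap1 mul1r scale1r.
- have [|p1 p2] := IHp; first by move=> x xp; apply: H; rewrite mem_cat xp.
  have [|q1 q2] := IHq; first by move=> x xq; apply: H; rewrite mem_cat xq orbT.
  by rewrite swapD; split; rewrite mulrDl ?(p1, p2) ?(q1, q2) -scalerDl.
- by have [p1 p2] := IHp H; rewrite swapZ -!scalerAl p1 p2 !scalerA.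
- have [|p1 p2] := IHp; first by move=> x xp; apply: H; rewrite mem_cat xp.
  have [|q1 q2] := IHq; first by move=> x xq; apply: H; rewrite mem_cat xq orbT.
  rewrite swapM -!mulrA q1 q2 -!scalerAr p1 p2 !scalerA.
  by split; congr (_ *: _); exact: mulrC.
- have [p1 p2] := IHp H.
  rewrite swap_tr tr_swap -scalerAl mulrDl p1 p2 -scalerDl scalerA.
  by split; congr (_ *: _); exact/esym/mulr1.
Qed.

(** If an identity of [D2 lambda] took a nonzero value [w], some nonzero [w * a]
    would be a joint eigenvector of the values of the variables and of their
    images by [swap]. Then [w] acts on [w * a] by the value of the identity at a
    point of [D2 lambda], that is by 0, so [(w * a) ^+ 2 = 0], which is impossible
    in a reduced algebra. *)
Theorem D2_identities_hold (X : choiceType) :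
  trace_identities X (D2 lambda) `<=` trace_identities X A.
Proof.
move=> f; elim/tfree_ind: f => p idp v; rewrite tevalE.
apply: contrapT => /eqP w0; set w := term_eval v p in w0.
have [a wa eig] := joint_eigenvector
  (map v (term_vars p) ++ map (swap \o v) (term_vars p)) frobA w0.
pose eigval z := odflt 0 [pick c : F | z * (w * a) == c *: (w * a)].
have eigvalP z : (exists c : F, z * (w * a) = c *: (w * a)) ->
    z * (w * a) = eigval z *: (w * a).
  by rewrite /eigval => -[c zc]; case: pickP => [b /eqP //|/(_ c)/eqP].
pose d x : D2 lambda := (eigval (v x), eigval (swap (v x))).
have [|wwa _] := @eigen_term_eval X v d (w * a) p.
  move=> x xp; split; apply: eigvalP; apply: eig; rewrite mem_cat; apply/orP.
    by left; exact: map_f.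
  by right; exact: (map_f (swap \o v)).
move: (idp d) wwa; rewrite tevalE => -> /=; rewrite scale0r -/w => wwa.
case/eqP: wa; apply: (frob_reduced frobA).
by rewrite -mulrA (frob_comm frobA a) mulrA wwa mul0r.
Qed.

End Completeness.

(** * Quotients of trace algebras *)

Record is_proper_trace_ideal (F : fieldType) (A : traceAlgType F) (J : set A) : Prop := {
  tideal0 : J 0;
  tidealD : forall a b, J a -> J b -> J (a + b);
  tidealMl : forall a b, J b -> J (a * b);
  tidealMr : forall a b, J a -> J (a * b);
  tideal_tr : forall a, J a -> J (tr a);
  tideal_proper : ~ J 1
}.

Section TraceQuotient.

Local Open Scope quotient_scope.

Variables (F : fieldType) (A : traceAlgType F) (J : set A).
Hypothesis idealJ : is_proper_trace_ideal J.

Lemma tidealZ c a : J a -> J (c *: a).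
Proof. by rewrite -mulr_algl; exact: tidealMl. Qed.

Lemma tidealN a : J a -> J (- a).
Proof. by rewrite -scaleN1r; exact: tidealZ. Qed.

Definition tideal_equiv (a b : A) : bool := `[< J (a - b) >].

Lemma tideal_equiv_class : equiv_class_of tideal_equiv.
Proof.
split.
- by move=> a; apply/asboolP; rewrite subrr; exact: tideal0.
- by move=> a b; apply/asboolP/asboolP => /tidealN; rewrite opprB.
- move=> b a c /asboolP ab /asboolP bc; apply/asboolP.
  by rewrite -(subrK b a) -addrA; exact: tidealD.
Qed.

Canonical tideal_equiv_rel := EquivRelPack tideal_equiv_class.

Definition tquot := {eq_quot tideal_equiv_rel}.

HB.instance Definition _ := Choice.on tquot.
HB.instance Definition _ := EqQuotient.on tquot.

Definition tproj (a : A) : tquot := \pi_tquot a.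

Lemma tprojP (a b : A) : tproj a = tproj b <-> J (a - b).
Proof. by split=> [/eqmodP/asboolP|ab]; last apply/eqmodP/asboolP. Qed.

Lemma tproj_ind (P : tquot -> Prop) : (forall a, P (tproj a)) -> forall z, P z.
Proof. by move=> H z; rewrite -[z]reprK; exact: H. Qed.

Let repr_tproj (a : A) : J (repr (tproj a) - a).
Proof. by apply/tprojP; rewrite /tproj reprK. Qed.

Definition tquot_add (z t : tquot) : tquot := tproj (repr z + repr t).
Definition tquot_scale c (z : tquot) : tquot := tproj (c *: repr z).
Definition tquot_mul (z t : tquot) : tquot := tproj (repr z * repr t).
Definition tquot_tr (z : tquot) : tquot := tproj (tr (repr z)).

Let addE a b : tquot_add (tproj a) (tproj b) = tproj (a + b).
Proof.
by apply/tprojP; rewrite opprD addrACA; apply: tidealD => //; exact: repr_tproj.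
Qed.
Let scaleE c a : tquot_scale c (tproj a) = tproj (c *: a).
Proof. by apply/tprojP; rewrite -scalerBr; apply: tidealZ; exact: repr_tproj. Qed.
Let mulE a b : tquot_mul (tproj a) (tproj b) = tproj (a * b).
Proof.
apply/tprojP; rewrite -(subrK (a * repr (tproj b)) (_ * _)) -mulrBl -addrA -mulrBr.
apply: tidealD => //.
  by apply: tidealMr => //; exact: repr_tproj.
by apply: tidealMl => //; exact: repr_tproj.
Qed.
Let trE a : tquot_tr (tproj a) = tproj (tr a).
Proof.
by apply/tprojP; rewrite -linearB; apply: tideal_tr => //; exact: repr_tproj.
Qed.

Let tE := (addE, scaleE, mulE, trE).

Ltac lift_eq H := do ?[elim/tproj_ind=> ?]; rewrite ?tE; congr tproj; exact: H.

Let addqA : associative tquot_add.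
Proof. lift_eq addrA. Qed.
Let addqC : commutative tquot_add.
Proof. lift_eq addrC. Qed.
Let add0q : left_id (tproj 0) tquot_add.
Proof. lift_eq add0r. Qed.
Let addNq : left_inverse (tproj 0) (tquot_scale (-1)) tquot_add.
Proof. by elim/tproj_ind=> a; rewrite !tE scaleN1r addNr. Qed.

HB.instance Definition _ := GRing.isZmodule.Build tquot addqA addqC add0q addNq.

Let mulqA : associative tquot_mul.
Proof. lift_eq mulrA. Qed.
Let mul1q : left_id (tproj 1) tquot_mul.
Proof. lift_eq mul1r. Qed.
Let mulq1 : right_id (tproj 1) tquot_mul.
Proof. lift_eq mulr1. Qed.
Let mulqDl : left_distributive tquot_mul tquot_add.
Proof. lift_eq mulrDl. Qed.
Let mulqDr : right_distributive tquot_mul tquot_add.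
Proof. lift_eq mulrDr. Qed.
Let oneq_neq0 : tproj 1 != 0.
Proof. by apply/eqP => /tprojP; rewrite subr0; exact: tideal_proper. Qed.

HB.instance Definition _ := GRing.Zmodule_isNzRing.Build tquot
  mulqA mul1q mulq1 mulqDl mulqDr oneq_neq0.

Let scaleqA a b (z : tquot) : tquot_scale a (tquot_scale b z) = tquot_scale (a * b) z.
Proof. move: z; lift_eq scalerA. Qed.
Let scale1q : left_id 1 tquot_scale.
Proof. lift_eq scale1r. Qed.
Let scaleqDr : right_distributive tquot_scale +%R.
Proof. by move=> c; rewrite /GRing.add /=; lift_eq scalerDr. Qed.
Let scaleqDl (z : tquot) : {morph tquot_scale^~ z : a b / a + b}.
Proof. by elim/tproj_ind: z => z a b; rewrite [in RHS]/GRing.add /= !tE scalerDl. Qed.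

HB.instance Definition _ := GRing.Zmodule_isLmodule.Build F tquot
  scaleqA scale1q scaleqDr scaleqDl.

Let scaleqAl (c : F) (z t : tquot) : c *: (z * t) = (c *: z) * t.
Proof. rewrite /GRing.scale /GRing.mul /=; move: z t; lift_eq scalerAl. Qed.

HB.instance Definition _ := GRing.Lmodule_isLalgebra.Build F tquot scaleqAl.

Let scaleqAr (c : F) (z t : tquot) : c *: (z * t) = z * (c *: t).
Proof. rewrite /GRing.scale /GRing.mul /=; move: z t; lift_eq scalerAr. Qed.

HB.instance Definition _ := GRing.Lalgebra_isAlgebra.Build F tquot scaleqAr.

Let trq_linear : linear tquot_tr.
Proof. by move=> c; rewrite /GRing.add /GRing.scale /=; lift_eq linearP. Qed.
Let trq_central (z t : tquot) : tquot_tr z * t = t * tquot_tr z.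
Proof. rewrite /GRing.mul /=; move: z t; lift_eq (@tr_central F A). Qed.
Let trqC (z t : tquot) : tquot_tr (z * t) = tquot_tr (t * z).
Proof. rewrite /GRing.mul /=; move: z t; lift_eq (@trC F A). Qed.
Let trqM (z t : tquot) : tquot_tr (tquot_tr z * t) = tquot_tr z * tquot_tr t.
Proof. rewrite /GRing.mul /=; move: z t; lift_eq (@trM F A). Qed.

HB.instance Definition _ :=
  hasTrace.Build F tquot trq_linear trq_central trqC trqM.

Lemma tproj_linear : linear tproj.
Proof. by move=> c a b; rewrite {2}/GRing.add {2}/GRing.scale /= !tE. Qed.

Lemma tproj_monoid_morphism : monoid_morphism tproj.
Proof. by split=> // a b; rewrite {2}/GRing.mul /= !tE. Qed.

HB.instance Definition _ := GRing.isLinear.Build F A tquot *:%R tproj tproj_linear.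
HB.instance Definition _ :=
  GRing.isMonoidMorphism.Build A tquot tproj tproj_monoid_morphism.

Lemma tproj_trace : trace_morphism tproj.
Proof. by move=> a; rewrite [in RHS]/tr /= !tE. Qed.

Lemma tproj_eq0 a : tproj a = 0 <-> J a.
Proof. by rewrite -(raddf0 tproj) tprojP subr0. Qed.

End TraceQuotient.

(** * T-ideals and relatively free trace algebras *)

Lemma trace_morphism_teval (F : fieldType) (X : Type) (A B : traceAlgType F)
    (phi : {lrmorphism A -> B}) (v : X -> A) (f : tfree F X) :
  trace_morphism phi -> phi (teval v f) = teval (phi \o v) f.
Proof.
move=> phit; apply: (@teval_unique F X B (phi \o v) (phi \o teval v)).
  by move=> g; rewrite /= teval_trace phit.
by move=> x; rewrite /= tevalX.
Qed.

Lemma trace_morphism_tfree (F : fieldType) (X : Type) (A : traceAlgType F)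
    (phi : {lrmorphism tfree F X -> A}) :
  trace_morphism phi -> phi =1 teval (phi \o tvar).
Proof. by move=> phit; apply: teval_unique. Qed.

Lemma trace_identities_Tideal (F : fieldType) (X : Type) (A : traceAlgType F) :
  is_Tideal (trace_identities X A).
Proof.
split.
- by move=> v; rewrite raddf0.
- by move=> f g If Ig v; rewrite raddfD /= If Ig addr0.
- by move=> g f If v; rewrite rmorphM /= If mulr0.
- by move=> f g If v; rewrite rmorphM /= If mul0r.
- by move=> f If v; rewrite teval_trace If raddf0.
- move=> phi phit f If v.
  rewrite (trace_morphism_tfree phit) (trace_morphism_teval (phi := teval v)) ?If //.
  exact: teval_trace.
Qed.

Lemma Tideal_gen_sub (F : fieldType) (X : Type) (S : set (tfree F X)) :
  S `<=` Tideal_gen S.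
Proof. by move=> f Sf I [_ SI]; exact: SI. Qed.

Lemma Tideal_gen_Tideal (F : fieldType) (X : Type) (S : set (tfree F X)) :
  is_Tideal (Tideal_gen S).
Proof.
split.
- by move=> I [II _]; exact: Tideal0.
- by move=> f g If Ig I [II SI]; apply: TidealD => //; [apply: If|apply: Ig].
- by move=> g f If I [II SI]; apply: TidealMl => //; apply: If.
- by move=> f g If I [II SI]; apply: TidealMr => //; apply: If.
- by move=> f If I [II SI]; apply: Tideal_tr => //; apply: If.
- by move=> phi phit f If I [II SI]; apply: Tideal_endo => //; apply: If.
Qed.

Lemma Tideal_proper_trace_ideal (F : fieldType) (X : Type) (I : set (tfree F X)) :
  is_Tideal I -> ~ I 1 -> is_proper_trace_ideal I.
Proof. by case=> ? ? ? ? ? _ ?; split. Qed.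

(** The quotient by a T-ideal [I] is the relatively free algebra of [I]. A value
    of [f] there lifts to the image of [f] under an endomorphism, and the value of
    [f] at the classes of the variables is the class of [f]. *)
Lemma tquot_identities (F : fieldType) (X : Type) (I : set (tfree F X))
    (TI : is_Tideal I) (I1 : ~ I 1) :
  trace_identities X (tquot (Tideal_proper_trace_ideal TI I1)) = I.
Proof.
have pit := tproj_trace (Tideal_proper_trace_ideal TI I1).
set pi := tproj _ in pit *; have piP := tproj_eq0 (Tideal_proper_trace_ideal TI I1).
apply/seteqP; split=> f.
  by move=> idf; apply/piP; exact: etrans (trace_morphism_tfree pit f) (idf _).
move=> If v.
have -> : v = pi \o (repr \o v).
  by apply/funext => x; rewrite /pi /= /tproj reprK.
rewrite -(trace_morphism_teval (phi := pi)) //; apply/piP.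
apply: (Tideal_endo TI) => //; exact: teval_trace.
Qed.


(** * Capelli polynomials on finite-dimensional algebras *)

Section CapelliVanishing.

Variables (F : fieldType) (X : choiceType) (A : traceAlgType F).

Definition upd (v : X -> A) (x : X) (a : A) : X -> A :=
  fun z => if z == x then a else v z.

Lemma mono_upd_notin (m : tmonomial X) v x a :
  x \notin mono_vars m -> teval (upd v x a) (mono F m) = teval v (mono F m).
Proof.
elim: m => /= [y||m IHm n IHn|m IHm].
- by rewrite inE !tevalX /upd eq_sym => /negPf ->.
- by rewrite !rmorph1.
- by rewrite mem_cat !rmorphM /= => /norP[/IHm-> /IHn->].
- by move=> /IHm; rewrite !teval_trace => ->.
Qed.

Lemma mono_upd_linear (I : finType) (c : I -> F) (e : I -> A)
    (m : tmonomial X) v x :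
  count_mem x (mono_vars m) = 1%N ->
  teval (upd v x (\sum_i c i *: e i)) (mono F m) =
  \sum_i c i *: teval (upd v x (e i)) (mono F m).
Proof.
elim: m => /= [y||m IHm n IHn|m IHm].
- rewrite addn0; case: eqP => // -> _; rewrite tevalX /upd eqxx.
  by apply: eq_bigr => i _; rewrite tevalX eqxx.
- by [].
- have notin (l : tmonomial X) : count_mem x (mono_vars l) = 0%N -> x \notin mono_vars l.
    by move=> l0; rewrite -has_pred1 has_count l0.
  rewrite count_cat rmorphM /=.
  case cm: (count_mem x (mono_vars m)) => [|[|k]] // => [cn|[cn]].
    rewrite IHn // mono_upd_notin ?notin // mulr_sumr.
    apply: eq_bigr => i _.
    by rewrite rmorphM /= -scalerAr (mono_upd_notin _ _ (notin m cm)).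
  rewrite IHm // (mono_upd_notin _ _ (notin n cn)) mulr_suml.
  apply: eq_bigr => i _.
  by rewrite rmorphM /= -scalerAl (mono_upd_notin _ _ (notin n cn)).
- move=> /IHm IH; rewrite teval_trace IH linear_sum /=.
  by apply: eq_bigr => i _; rewrite teval_trace linearZ_LR.
Qed.

Lemma multilinear_upd (I : finType) (c : I -> F) (e : I -> A) vs f v x :
  multilinear vs f -> x \in vs ->
  teval (upd v x (\sum_i c i *: e i)) f = \sum_i c i *: teval (upd v x (e i)) f.
Proof.
move=> [uvs [s + ->]] xvs; elim: s => [_|[b m] s IH /= /andP[/seq.permP mP sP]].
  rewrite big_nil raddf0 big1 // => i _; by rewrite raddf0 scaler0.
have mx : count_mem x (mono_vars m) = 1%N by rewrite mP count_uniq_mem // xvs.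
rewrite big_cons raddfD /= IH // linearZ_LR /= mono_upd_linear //.
rewrite scaler_sumr -big_split; apply: eq_bigr => i _ /=.
by rewrite raddfD /= scalerDr [in RHS]linearZ_LR /= !scalerA mulrC.
Qed.

(** Each variable of [xs] in turn is expanded in the spanning family [e]. *)
Lemma multilinear_basis (I : finType) (e : I -> A) (vs xs : seq X) (f : tfree F X) :
  (forall a, exists c : I -> F, a = \sum_i c i *: e i) ->
  multilinear vs f -> {subset xs <= vs} ->
  (forall v : X -> A, (forall x, x \in xs -> exists i, v x = e i) -> teval v f = 0) ->
  forall v : X -> A, teval v f = 0.
Proof.
move=> span mf; elim: xs => [|x xs IH] sub H v; first by apply: H => x; rewrite in_nil.
apply: IH v => [y yxs|v vP]; first by rewrite sub // inE yxs orbT.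
have [c vx] := span (v x).
have -> : v = upd v x (\sum_i c i *: e i).
  by apply/funext => z; rewrite /upd; case: eqP => // ->.
rewrite (multilinear_upd _ _ _ mf) ?sub ?mem_head // big1 // => i _.
rewrite H ?scaler0 // => y; rewrite inE /upd; case: eqP => [_ _|_ /vP//].
by exists i.
Qed.

(** By multilinearity the alternating variables may be taken in a spanning family.
    It has fewer than [m] members, so two of these variables receive the same
    value, and identifying them kills the polynomial. *)
Lemma Capelli_vanish (I : finType) (e : I -> A) m :
  (forall a, exists c : I -> F, a = \sum_i c i *: e i) ->
  (#|I| < m)%N -> Capelli F X m `<=` trace_identities X A.
Proof.
move=> span ltIm f [xs [ys [sz mf alt]]].
apply: (multilinear_basis (xs := xs) span mf).
  by move=> x xxs; rewrite mem_cat xxs.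
move=> v vP; have uxs : uniq xs by case: mf => + _; rewrite cat_uniq => /andP[].
have [x [y [xxs yxs xy vxy]]] :
    exists x y, [/\ x \in xs, y \in xs, x != y & v x = v y].
  apply: contrapT => inj_v.
  have uv : uniq (map v xs).
    rewrite map_inj_in_uniq // => x y xxs yxs vxy; apply/eqP; apply: contraT => xy.
    by case: inj_v; exists x, y.
  have /(uniq_leq_size uv) : {subset map v xs <= map e (enum I)}.
    by move=> _ /mapP[x /vP[i ->] ->]; rewrite map_f ?mem_enum.
  by rewrite !size_map sz -enumT -cardE leqNgt ltIm.
have := congr1 (teval v) (alt x y xxs yxs xy).
rewrite raddf0 trace_morphism_teval; last exact: teval_trace.
congr (teval _ f = 0); apply/funext => z /=.
by case: eqP => [->|_]; rewrite tevalX.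
Qed.

End CapelliVanishing.

(** * A Capelli polynomial of order 3 *)

Section Capelli3.

Variables (F : fieldType) (X : choiceType).

Definition cap3_mono (y1 y2 a b c : X) : tmonomial X :=
  MMul (MMul (MTr (MMul (MVar y1) (MVar a))) (MTr (MMul (MVar y2) (MVar b)))) (MVar c).

(** The sum of [(-1)^s t(y1 x_s1) t(y2 x_s2) x_s3] over the permutations [s] of
    three letters. With [x = (g, h, k)] and [y = (g, h)] for orthogonal [g], [h],
    [k], only the term of the identity permutation survives. *)
Definition cap3 (y1 y2 a b c : X) : tfree F X :=
  \sum_(cm <- [:: (1, cap3_mono y1 y2 a b c); (-1, cap3_mono y1 y2 b a c);
                  (1, cap3_mono y1 y2 b c a); (-1, cap3_mono y1 y2 c b a);
                  (1, cap3_mono y1 y2 c a b); (-1, cap3_mono y1 y2 a c b)])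
     cm.1 *: mono F cm.2.

(** Each transposition is bracketed with an even permutation so that a repeated
    variable cancels one bracket and makes the other two opposite. *)
Lemma teval_cap3 (A : traceAlgType F) (v : X -> A) y1 y2 a b c :
  let T x y z := tr (v y1 * v x) * tr (v y2 * v y) * v z in
  teval v (cap3 y1 y2 a b c) =
    T a b c - T b a c + (T b c a - T c b a) + (T c a b - T a c b).
Proof.
move=> T; have E x y z : teval v (mono F (cap3_mono y1 y2 x y z)) = T x y z.
  by rewrite /= !rmorphM /= !teval_trace !rmorphM /= !tevalX.
rewrite /cap3 !big_cons big_nil addr0 /= !raddfD /= !linearZ /= !E.
by rewrite !scale1r !scaleN1r !addrA.
Qed.

Lemma cap3_Capelli y1 y2 a b c :
  uniq [:: a; b; c; y1; y2] -> Capelli F X 3 (cap3 y1 y2 a b c).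
Proof.
move=> uvs; exists [:: a; b; c], [:: y1; y2]; split=> //.
  split=> //; eexists; last by reflexivity.
  (* The order of the x's in a monomial is immaterial. *)
  have P x y z : perm_eq [:: x; y; z] [:: a; b; c] ->
      perm_eq (mono_vars (cap3_mono y1 y2 x y z)) ([:: a; b; c] ++ [:: y1; y2]).
    move=> /seq.permP xyz; apply/seq.permP => p; move: (xyz p) => /=; lia.
  by do !(apply/andP; split; first by apply: P; apply/seq.permP => p /=; lia).
move=> x y xabc yabc xy; set v := fun z => _.
have vxy : v x = v y by rewrite /v eqxx (negPf xy).
have cancel (p q : tfree F X) : p - q + (q - p) = 0.
  by rewrite addrA subrK subrr.
rewrite teval_cap3.
suff: [\/ v a = v b, v a = v c | v b = v c].
  by case=> ->; rewrite subrr ?addr0 ?add0r cancel.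
clearbody v; move: xabc yabc xy vxy; rewrite !inE.
move=> /or3P[] /eqP -> /or3P[] /eqP ->; rewrite ?eqxx // => _ vxy;
  by [apply: Or31 | apply: Or32 | apply: Or33].
Qed.

End Capelli3.

(** * The generators are identities *)

Section Generators.

Variables (F : finFieldType) (lambda : F) (X : choiceType) (x : X).

(** Twice the Cayley-Hamilton polynomial [x ^ 2 - T x + D] of a diagonal matrix of
    order 2, where [T = lambda^-1 t(x)] and [2 D = T ^ 2 - lambda^-1 t(x ^ 2)]. *)
Definition cayley_hamilton : tfree F X :=
  (lambda^-1 *: tr (tvar x)) ^+ 2 - lambda^-1 *: tr (tvar x ^+ 2)
    - 2%:R * (lambda^-1 *: tr (tvar x) - tvar x) * tvar x.

Lemma teval_cayley_hamilton (A : traceAlgType F) (v : X -> A) (a := v x) :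
  teval v cayley_hamilton =
  (lambda^-1 *: tr a) ^+ 2 - lambda^-1 *: tr (a ^+ 2)
    - 2%:R * (lambda^-1 *: tr a - a) * a.
Proof.
rewrite /cayley_hamilton !rmorphB /= rmorphXn !rmorphM /= rmorph_nat rmorphB /=.
by rewrite !linearZ /= !teval_trace rmorphXn /= tevalX.
Qed.

Lemma D2_cayley_hamilton :
  lambda != 0 -> trace_identities X (D2 lambda) cayley_hamilton.
Proof.
move=> lambda0 v; rewrite teval_cayley_hamilton; case: (v x) => a b.
have addP (c d c' d' : F) : (c, d) + (c', d') = (c + c', d + d') :> D2 lambda by [].
have oppP (c d : F) : - ((c, d) : D2 lambda) = (- c, - d) by [].
have mulP (c d c' d' : F) : (c, d) * (c', d') = (c * c', d * d') :> D2 lambda by [].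
have trP (c d : F) : lambda^-1 *: tr ((c, d) : D2 lambda) = (c + d, c + d).
  by rewrite scalerA mulrA mulVf // mul1r; congr pair; exact: mulr1.
have two : (2%:R : D2 lambda) = (2%:R, 2%:R) by [].
rewrite two !expr2 (mulP a b a b) !trP !(mulP, oppP, addP) -[RHS]/(0, 0).
by congr pair; rewrite /=; ring.
Qed.

Lemma D2_frobenius : trace_identities X (D2 lambda) (tvar x ^+ #|F| - tvar x).
Proof.
move=> v; rewrite rmorphB rmorphXn /= tevalX; case: (v x) => a b.
have pairX n : (a, b) ^+ n = (a ^+ n, b ^+ n) :> D2 lambda.
  by elim: n => // n IH; rewrite !exprS IH.
by rewrite pairX !expf_card subrr.
Qed.

Lemma D2_tr1 : trace_identities X (D2 lambda) (tr 1 - (2%:R * lambda)%:A).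
Proof.
move=> v; rewrite rmorphB /= teval_trace linearZ /= rmorph1.
have -> : tr (1 : D2 lambda) = (2%:R * lambda)%:A by rewrite mulrC.
by rewrite subrr.
Qed.

Lemma D2_Capelli : Capelli F X 3 `<=` trace_identities X (D2 lambda).
Proof.
pose e (i : bool) : D2 lambda := if i then (1, 0) else (0, 1).
apply: (@Capelli_vanish F X (D2 lambda) bool e); last by rewrite card_bool.
move=> [a b]; exists (fun i : bool => if i then a else b).
rewrite big_bool /=.
by congr pair; rewrite /= scaler0 ?addr0 ?add0r; exact/esym/mulr1.
Qed.

End Generators.

Lemma infinite_uniq (T : choiceType) n :
  infinite_set [set: T] -> exists2 s : seq T, uniq s & size s = n.
Proof.
move=> /(@infinite_set_fset _ _ n)[B _ nB].
exists (take n (finmap.enum_fset B)); rewrite ?size_takel //.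
by rewrite take_uniq // finmap.fset_uniq.
Qed.

Theorem theorem20 (F : finFieldType) (lambda : F) (X : choiceType) (x : X) :
  infinite_set [set: X] ->
  lambda != 0 ->
  trace_identities X (D2 lambda) =
  Tideal_gen
    ([set (lambda^-1 *: tr (tvar x)) ^+ 2 - lambda^-1 *: tr (tvar x ^+ 2)
            - 2%:R * (lambda^-1 *: tr (tvar x) - tvar x) * tvar x]
     `|` [set tvar x ^+ #|F| - tvar x]
     `|` Capelli F X 3%N
     `|` [set tr 1 - (2%:R * lambda)%:A]).
Proof.
move=> Xinf lambda0; set S := (S in Tideal_gen S).
have TI := Tideal_gen_Tideal S.
have I_D2 : Tideal_gen S `<=` trace_identities X (D2 lambda).
  move=> f; apply; split; first exact: trace_identities_Tideal.
  move=> g [[[->|->]|capg]|->].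
  - exact: D2_cayley_hamilton.
  - exact: D2_frobenius.
  - exact: D2_Capelli.
  - exact: D2_tr1.
have I1 : ~ Tideal_gen S 1.
  move=> /I_D2/(_ (fun=> 0)); rewrite rmorph1 => /eqP; by rewrite oner_eq0.
apply/seteqP; split=> //.
rewrite -(tquot_identities TI I1); set A := tquot _.
have S_A f : S f -> trace_identities X A f.
  by move=> Sf; rewrite tquot_identities; exact: Tideal_gen_sub.
apply: D2_identities_hold => //.
- move=> a; have /(_ (fun=> a)) : trace_identities X A (tvar x ^+ #|F| - tvar x).
    by apply: S_A; left; left; right.
  by rewrite rmorphB rmorphXn /= tevalX => /subr0_eq.
- have /(_ (fun=> 0)) : trace_identities X A (tr 1 - (2%:R * lambda)%:A).
    by apply: S_A; right.
  by rewrite rmorphB /= teval_trace linearZ /= rmorph1 => /subr0_eq.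
- move=> a; have /(_ (fun=> a)) : trace_identities X A (cayley_hamilton lambda x).
    by apply: S_A; left; left; left.
  by rewrite teval_cayley_hamilton.
move=> g h k gg hh gh gk hk.
have [[|y1 [|y2 [|a [|b [|c [|? ?]]]]]] // us _] := infinite_uniq 5 Xinf.
set s := [:: y1; y2; a; b; c] in us.
(* The two auxiliary variables select g and h; the alternating ones receive
   g, h and k. *)
pose v z : A := nth k [:: g; h; g; h; k] (index z s).
have vE i : (i < 5)%N -> v (nth y1 s i) = nth k [:: g; h; g; h; k] i.
  by move=> i5; rewrite /v index_uniq.
have capA : trace_identities X A (cap3 F y1 y2 a b c).
  apply: S_A; left; right; apply: cap3_Capelli.
  by rewrite -(rot_uniq 2) in us.
have := capA v; rewrite teval_cap3.
rewrite (vE 0 isT) (vE 1 isT) (vE 2 isT) (vE 3 isT) (vE 4 isT) /=.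
by rewrite gg hh gh gk hk !raddf0 !(mul0r, mulr0) !subr0 !addr0.
Qed.
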